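(* Let $u$ be a metric viscosity solution on a complete unbounded length space $(\mathcal{Y},d)$ (that is, on $\Omega=\mathcal{Y}$). Then for any point $y_0\in\mathcal{Y}$ and every $\varepsilon>0$, there exists a regular curve $\gamma:[0,\infty)\to\mathcal{Y}$ with $\gamma(0)=y_0$ such that $$u(\gamma(t_1))-u(\gamma(t_2))\ge d(\gamma(t_2),\gamma(t_1))-\varepsilon\quad\text{for all } t_2\ge t_1\ge 0,$$ and $\lim_{t\to\infty}d(y_0,\gamma(t))=\infty$.
   Context: A length space is a metric space in which the distance between any two points equals the infimum of the lengths of the rectifiable curves joining them. Metric viscosity solution: for an open set $\Omega\subset\mathcal{Y}$ and $u:\Omega\to\mathbb{R}$, the local slope at $y\in\Omega$ is $|\partial u|(y)=\limsup_{x\in\Omega,\,x\to y}\frac{(u(y)-u(x))^+}{d(y,x)}$. A locally Lipschitz function $u:\Omega\to\mathbb{R}$ is a metric viscosity solution (of the eikonal equation $|\nabla u|=1$ in $\Omega$) if $|\partial u|(y)=1$ for every $y\in\Omega$. Regular curve: a continuous curve $\gamma:I\to\mathcal{Y}$ on a non-degenerate interval $I\subset\mathbb{R}$ is rectifiable if its length on each bounded closed subinterval of $I$ is finite; it is regular if it is rectifiable and its speed $|\gamma'|(t)$ is nonzero for almost every $t\in I$. Here $|\gamma'|$ is the a.e. derivative of the arclength function $s_\gamma(t)=L(\gamma|_{[a,t]})$, equivalently $|\gamma'|(t)=\lim_{\tau\to0}d(\gamma(t+\tau),\gamma(t))/|\tau|$ for a.e. $t$. *)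

(* Defs.v *)
From HB Require Import structures.
From mathcomp Require Import all_boot all_order all_algebra.
From mathcomp Require Import all_classical all_reals all_analysis.

Set Implicit Arguments.
Unset Strict Implicit.
Unset Printing Implicit Defensive.
Import Order.TTheory GRing.Theory Num.Theory.
Import numFieldNormedType.Exports.
Local Open Scope classical_set_scope.
Local Open Scope ring_scope.

(* The base point that the library requires of complete spaces is no real
   restriction: it only makes the space nonempty. *)
#[short(type="completeMetricType")]
HB.structure Definition CompleteMetric (K : numDomainType) :=
  { Y of CompletePseudoMetric K Y & Metric K Y }.

Definition unbounded_space (R : realType) (Y : metricType R) : Prop :=
  forall M : R, exists x y : Y, M < mdist x y.

(* Curves are total functions gamma : R -> Y, of which only the restriction to
   the relevant interval matters. *)

(* Length of the restriction of gamma to [a, b]; for b < a there is no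
   partition and the value is -oo. *)
Definition curve_length (R : realType) (Y : metricType R)
    (gamma : R -> Y) (a b : R) : \bar R :=
  ereal_sup [set (\sum_(i < size s)
                    mdist (gamma (nth b (a :: s) i)) (gamma (nth b s i)))%:E
            | s in itv_partition a b].

Definition rectifiable (R : realType) (Y : metricType R)
    (I : interval R) (gamma : R -> Y) : Prop :=
  {within [set` I], continuous gamma} /\
  forall a b : R, a \in I -> b \in I -> a <= b ->
    (curve_length gamma a b < +oo)%E.

Definition length_space (R : realType) (Y : metricType R) : Prop :=
  forall x y : Y,
    (mdist x y)%:E = ereal_inf [set L : \bar R |
      exists a b : R, exists gamma : R -> Y,
        [/\ a < b, rectifiable `[a, b] gamma, gamma a = x, gamma b = y
          & L = curve_length gamma a b]].

Definition arclength (R : realType) (Y : metricType R)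
    (gamma : R -> Y) (a t : R) : R := fine (curve_length gamma a t).

(* Regularity of a curve on an interval I with left endpoint a \in I. The speed
   at t is the derivative at t of the arclength function based at a; its
   behaviour at an endpoint of I is irrelevant, endpoints being negligible. *)
Definition regular_curve (R : realType) (Y : metricType R)
    (a : R) (I : interval R) (gamma : R -> Y) : Prop :=
  rectifiable I gamma /\
  {ae @lebesgue_measure R, forall t : R, t \in I ->
     derivable (arclength gamma a) t 1 /\ derive1 (arclength gamma a) t != 0}.

(* The limsup is over x <> y in Omega; at an isolated point it is -oo, the
   supremum of the empty set in \bar R. *)
Definition local_slope (R : realType) (Y : metricType R)
    (Omega : set Y) (u : Y -> R) (y : Y) : \bar R :=
  limf_esup (fun x => (Num.max (u y - u x) 0 / mdist y x)%:E)
            (within Omega y^').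

Definition locally_lipschitz (R : realType) (Y : metricType R)
    (Omega : set Y) (u : Y -> R) : Prop :=
  forall y, Omega y -> exists (L : R) (V : set Y), nbhs y V /\
    forall x z, (V `&` Omega) x -> (V `&` Omega) z ->
      `|u x - u z| <= L * mdist x z.

(* Intended for open Omega; u is only looked at on Omega. *)
Definition metric_viscosity_solution (R : realType) (Y : metricType R)
    (Omega : set Y) (u : Y -> R) : Prop :=
  locally_lipschitz Omega u /\
  forall y, Omega y -> local_slope Omega u y = 1%E.

(* Main.v *)
Require Import Defs.
From mathcomp Require Import all_boot all_order all_algebra.
From mathcomp Require Import all_classical all_reals all_analysis.
From mathcomp Require Import lra.

Import Order.TTheory GRing.Theory Num.Theory.
Import numFieldNormedType.Exports.
Local Open Scope classical_set_scope.
Local Open Scope ring_scope.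

(* Ekeland's principle on the closed unit ball around y gives a point x that is
   minimal for the relation "u drops from x to z by at least (1 - e) d(x, z)".
   As the slope is 1 at x, some z close to x lies strictly below x, hence
   outside the ball: so 1 < d(y, z) <= 2 and u drops from y to z by at least
   (1 - e) d(y, z). Joining y to z by an almost shortest curve, parametrized by
   arclength, and iterating with summable errors yields a unit-speed ray along
   which u drops by at least t - eps on [0, t]. Since u is 1-Lipschitz, this
   bound at the ends propagates to every subinterval, and it forces the ray to
   infinity. *)

(** * Length of curves through inscribed polygons: lower bounds and additivity *)

Section Length.
Context {R : realType} {Y : metricType R}.
Implicit Types (gamma eta : R -> Y) (a b c : R) (s : seq R).

(** The indexed sum of [curve_length] in recursive form, so that inductions over a partition run
    along [path] and [last]. *)
Fixpoint polygon_length gamma a s : R :=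
  if s is b :: s' then mdist (gamma a) (gamma b) + polygon_length gamma b s'
  else 0.

Lemma curve_lengthE gamma a b : curve_length gamma a b =
  ereal_sup [set (polygon_length gamma a s)%:E | s in itv_partition a b].
Proof.
rewrite /curve_length; congr ereal_sup. apply: eq_imagel => s _; congr EFin.
elim: s a => [|x s IH] a; first by rewrite big_ord0.
by rewrite big_ord_recl /= -IH.
Qed.

Lemma polygon_length_le {gamma a b s} : path <%R a s -> last a s = b ->
  ((polygon_length gamma a s)%:E <= curve_length gamma a b)%E.
Proof.
move=> sa sb; rewrite curve_lengthE; apply: ereal_sup_ubound.
by exists s => //; split=> //; apply/eqP.
Qed.

Lemma curve_length_le {gamma a b} {l : \bar R} :
  (forall s, path <%R a s -> last a s = b ->
    ((polygon_length gamma a s)%:E <= l)%E) ->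
  (curve_length gamma a b <= l)%E.
Proof.
move=> H; rewrite curve_lengthE; apply: ge_ereal_sup => _ [s [sa /eqP sb] <-].
exact: H.
Qed.

Lemma polygon_length_approx {gamma a b} {l : \bar R} :
  (l < curve_length gamma a b)%E ->
  exists s, [/\ path <%R a s, last a s = b & (l < (polygon_length gamma a s)%:E)%E].
Proof.
rewrite curve_lengthE => /ereal_sup_gt [_ [s [sa /eqP sb] <-] ls].
by exists s.
Qed.

Lemma path_last_ge {a s} : path <%R a s -> a <= last a s.
Proof.
elim: s a => //= x s IH a /andP[ax /IH]; exact/le_trans/ltW.
Qed.

Lemma mdist_le_curve_length gamma {a b} : a <= b ->
  ((mdist (gamma a) (gamma b))%:E <= curve_length gamma a b)%E.
Proof.
rewrite le_eqVlt => /predU1P[<-|ab].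
  rewrite mdistxx; exact: (@polygon_length_le _ _ _ [::]).
rewrite -[mdist _ _]addr0; apply: (@polygon_length_le _ _ _ [:: b]) => //=.
by rewrite ab.
Qed.

(** Only the edge that crosses [b] changes when [b] is inserted as a node, and the triangle
    inequality shows that this cannot shorten the polygon. *)
Lemma polygon_length_split gamma {a b c s} :
  a <= b -> b <= c -> path <%R a s -> last a s = c ->
  exists s1 s2, [/\ path <%R a s1, last a s1 = b, path <%R b s2, last b s2 = c
    & polygon_length gamma a s <= polygon_length gamma a s1 + polygon_length gamma b s2].
Proof.
elim: s a => [|x s IH] a /=.
  move=> ab bc _ ac; have -> : b = a by apply: le_anti; rewrite ab andbT ac.
  by exists [::], [::]; rewrite /= addr0.
rewrite le_eqVlt => /predU1P[<-|ab] bc /andP[ax xs] sc.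
  by exists [::], (x :: s); rewrite /= ax add0r.
have [bx|xb] := ltP b x.
  exists [:: b], (x :: s); rewrite /= ab bx addr0 addrA lerD2r.
  by split=> //; exact: metric_triangle.
have [s1 [s2 [p1 l1 p2 l2 le12]]] := IH x xb bc xs sc.
exists (x :: s1), s2; rewrite /= ax; split=> //.
by rewrite -addrA lerD2l.
Qed.

Lemma polygon_length_cat gamma a s1 s2 : polygon_length gamma a (s1 ++ s2) =
  polygon_length gamma a s1 + polygon_length gamma (last a s1) s2.
Proof. by elim: s1 a => [|x s IH] a /=; rewrite ?add0r// IH addrA. Qed.

Lemma curve_length_ge0 gamma {a b} : a <= b -> (0 <= curve_length gamma a b)%E.
Proof.
by move=> /(mdist_le_curve_length gamma); apply: le_trans; rewrite lee_fin mdist_ge0.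
Qed.

(** Splitting a polygon at [b] gives one inequality. Concatenating polygons gives the other, with
    the supremum taken first over the right piece and then over the left one. *)
Lemma curve_lengthD gamma {a b c} : a <= b -> b <= c ->
  curve_length gamma a c = (curve_length gamma a b + curve_length gamma b c)%E.
Proof.
move=> ab bc; apply/eqP; rewrite eq_le; apply/andP; split.
  apply: curve_length_le => s sa sc.
  have [s1 [s2 [p1 l1 p2 l2 le12]]] := polygon_length_split gamma ab bc sa sc.
  apply: (@le_trans _ _ ((polygon_length gamma a s1)%:E +
    (polygon_length gamma b s2)%:E)%E); first by rewrite -EFinD lee_fin.
  by apply: leeD; exact: polygon_length_le.
have key s1 : path <%R a s1 -> last a s1 = b ->
  ((polygon_length gamma a s1)%:E + curve_length gamma b c <= curve_length gamma a c)%E.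
  move=> p1 l1; rewrite addeC -leeBrDr//; apply: curve_length_le => s2 p2 l2.
  rewrite leeBrDr// addeC -EFinD -[in polygon_length _ b _]l1 -polygon_length_cat.
  by apply: polygon_length_le; rewrite ?cat_path ?last_cat ?p1 l1 ?p2.
(* An infinite right piece cannot be moved across the inequality. A single partition of [[a, b]]
   then suffices, the empty one if [a = b]. *)
have [bcoo|noo] := eqVneq (curve_length gamma b c) +oo%E.
  have [p1 l1] : itv_partition a b (if a == b then [::] else [:: b]).
    by case: ifPn => [/eqP ->|n] //; split; rewrite //= lt_neqAle n ab.
  have := key _ p1 (eqP l1).
  by rewrite bcoo addey// leye_eq => /eqP ->; rewrite leey.
have bcfin : curve_length gamma b c \is a fin_num.
  by rewrite ge0_fin_numE ?curve_length_ge0// lt_neqAle noo leey.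
rewrite -leeBrDr//; apply: curve_length_le => s1 p1 l1.
by rewrite leeBrDr//; exact: key.
Qed.

End Length.

(** * Arclength of rectifiable curves and parametrization by arclength *)

Section Reparametrization.
Context {R : realType} {Y : metricType R}.
Implicit Types (gamma eta : R -> Y) (a b c : R).

Lemma eq_curve_length {gamma eta a b} :
  (forall x, a <= x <= b -> gamma x = eta x) ->
  curve_length gamma a b = curve_length eta a b.
Proof.
move=> ge; rewrite !curve_lengthE; congr ereal_sup.
apply: eq_imagel => s [sa /eqP sb]; congr EFin.
elim: s a ge sa sb => //= x s IH a ge /andP[ax xs] sb.
have xb := path_last_ge xs; rewrite sb in xb.
rewrite !ge ?lexx ?(ltW ax) ?(le_trans (ltW ax))// IH// => y /andP[xy yb].
by rewrite ge// yb (le_trans (ltW ax)).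
Qed.

Lemma within_continuous_mdist {gamma a b t e} :
  {within `[a, b], continuous gamma} -> a <= t <= b -> 0 < e ->
  exists2 d, 0 < d & forall x, a <= x <= b -> `|t - x| < d ->
    mdist (gamma t) (gamma x) < e.
Proof.
move=> /subspace_continuousP cg tab e0.
have /metricType_numDomainType.cvgrPdist_lt/(_ _ e0) : gamma @ within `[a, b] (nbhs t) --> gamma t.
  by apply: cg; rewrite /= in_itv.
move=> /nbhs_ballP[d /= d0 H]; exists d => // x xab tx.
by apply: H => //=; rewrite in_itv.
Qed.

Section Rectifiable.
Context {eta : R -> Y} {a b : R}.
Hypothesis eta_rect : rectifiable `[a, b] eta.

Lemma curve_length_arclength {t} : a <= t <= b ->
  curve_length eta a t = (arclength eta a t)%:E.
Proof.
move=> /andP[at_ tb]; rewrite /arclength fineK// ge0_fin_numE ?curve_length_ge0//.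
by apply: eta_rect.2; rewrite ?in_itv/= ?lexx ?at_ ?tb ?(le_trans at_ tb).
Qed.

Lemma curve_length_arclengthB {s t} : a <= s -> s <= t -> t <= b ->
  curve_length eta s t = (arclength eta a t - arclength eta a s)%:E.
Proof.
move=> as_ st tb; rewrite EFinB -!curve_length_arclength ?as_ ?tb ?(le_trans st)
  ?(le_trans as_)// (curve_lengthD eta as_ st) addeAC.
by rewrite curve_length_arclength ?as_ ?(le_trans st tb)// subee// add0e.
Qed.

Lemma arclengthxx : a <= b -> arclength eta a a = 0.
Proof.
move=> ab; have := @curve_length_arclengthB a a.
by rewrite subrr curve_length_arclength ?lexx ?ab// => /(_ isT isT isT)[].
Qed.

Lemma arclength_le {s t} : a <= s -> s <= t -> t <= b ->
  arclength eta a s <= arclength eta a t.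
Proof.
move=> as_ st tb; have := curve_length_ge0 eta st.
by rewrite curve_length_arclengthB// lee_fin subr_ge0.
Qed.

(** Take a polygon on [[t, b]] within [e / 2] of the length and insert a node [x] so near [t] that
    the edge from [t] to [x] is shorter than [e / 2]. The rest of the polygon is bounded by the
    length on [[x, b]], so less than [e] remains for [[t, x]]. *)
Lemma arclength_right {t e} : a <= t -> t < b -> 0 < e ->
  exists x, [/\ t < x, x <= b & arclength eta a x - arclength eta a t < e].
Proof.
move=> at_ tb e0.
have e20 : 0 < e / 2 by lra.
have : ((arclength eta a b - arclength eta a t - e / 2)%:E < curve_length eta t b)%E.
  by rewrite curve_length_arclengthB ?(ltW tb)// lte_fin; lra.
move=> /polygon_length_approx[[|y s] []] /=.
  by move=> _ tb'; move: tb; rewrite tb' ltxx.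
move=> /andP[ty ys] sb; rewrite lte_fin => Lt.
have yb := path_last_ge ys; rewrite sb in yb.
have tab : a <= t <= b by rewrite at_ ltW.
have [d d0 Hd] := within_continuous_mdist eta_rect.1 tab e20.
pose x := t + Num.min (y - t) d / 2.
have m0 : 0 < Num.min (y - t) d by rewrite lt_min d0 subr_gt0 ty.
have mt : Num.min (y - t) d <= y - t by rewrite ge_min lexx.
have md : Num.min (y - t) d <= d by rewrite ge_min lexx orbT.
have tx : t < x by rewrite /x; lra.
have xy : x < y by rewrite /x; lra.
have xb := le_trans (ltW xy) yb.
have ax := le_trans at_ (ltW tx).
exists x; split=> //.
have dtx : mdist (eta t) (eta x) < e / 2.
  by apply: Hd; [rewrite ax xb|rewrite ltr_norml/x; apply/andP; split; lra].
have tri := metric_triangle (eta t) (eta x) (eta y).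
have : ((polygon_length eta x (y :: s))%:E <= curve_length eta x b)%E.
  by apply: polygon_length_le => //=; rewrite xy.
rewrite curve_length_arclengthB// lee_fin /=; lra.
Qed.

(** Mirror image of [arclength_right]: the new node goes into the last edge of the polygon, hence
    the decomposition from the end by [lastP]. *)
Lemma arclength_left {t e} : a < t -> t <= b -> 0 < e ->
  exists x, [/\ a <= x, x < t & arclength eta a t - arclength eta a x < e].
Proof.
move=> at_ tb e0.
have e20 : 0 < e / 2 by lra.
have tab : a <= t <= b by rewrite tb ltW.
have : ((arclength eta a t - e / 2)%:E < curve_length eta a t)%E.
  by rewrite curve_length_arclength// lte_fin; lra.
move=> /polygon_length_approx[s []]; case/lastP: s => [|s z] /=.
  by move=> _ tb'; move: at_; rewrite tb' ltxx.
rewrite rcons_path last_rcons => /andP[ps yz] zt; subst z.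
set y := last a s in yz; have ay : a <= y := path_last_ge ps.
rewrite -cats1 polygon_length_cat /= addr0 lte_fin -/y => Lt.
have [d d0 Hd] := within_continuous_mdist eta_rect.1 tab e20.
pose x := t - Num.min (t - y) d / 2.
have m0 : 0 < Num.min (t - y) d by rewrite lt_min d0 subr_gt0 yz.
have mt : Num.min (t - y) d <= t - y by rewrite ge_min lexx.
have md : Num.min (t - y) d <= d by rewrite ge_min lexx orbT.
have xt : x < t by rewrite /x; lra.
have yx : y < x by rewrite /x; lra.
have ax := le_trans ay (ltW yx).
have xb := le_trans (ltW xt) tb.
exists x; split=> //.
have dtx : mdist (eta t) (eta x) < e / 2.
  by apply: Hd; [rewrite ax xb|rewrite ltr_norml/x; apply/andP; split; lra].
have tri := metric_triangle (eta y) (eta x) (eta t).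
rewrite [mdist (eta x) _]metric_sym in tri.
have : ((polygon_length eta a (rcons s x))%:E <= curve_length eta a x)%E.
  by apply: polygon_length_le; rewrite ?last_rcons// rcons_path ps.
rewrite curve_length_arclength ?ax// lee_fin -cats1 polygon_length_cat /= addr0 -/y; lra.
Qed.

(** Intermediate values for a monotone function: at the supremum of the points with arclength at
    most [v], continuity from the left excludes a larger value and continuity from the right a
    smaller one. *)
Lemma arclength_surj {v} : a <= b -> 0 <= v <= arclength eta a b ->
  exists t, a <= t <= b /\ arclength eta a t = v.
Proof.
move=> ab /andP[v0 vL].
have A0 := arclengthxx ab.
pose S := [set t | a <= t <= b /\ arclength eta a t <= v].
have Sa : S a by split; rewrite ?lexx ?ab// A0.
have Sub : ubound S b by move=> x [/andP[]].
have hS : has_sup S by split; [exists a|exists b].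
pose t := sup S.
have at_ : a <= t by apply: ub_le_sup => //; exists b.
have tb : t <= b by apply: ge_sup => //; exists a.
exists t; rewrite at_ tb; split=> //; apply/eqP; rewrite eq_le; apply/andP; split.
- rewrite leNgt; apply/negP => vt.
  have ltat : a < t.
    rewrite lt_neqAle at_ andbT; apply: contraTneq vt => <-.
    by rewrite A0 -leNgt.
  have vt' : 0 < arclength eta a t - v by lra.
  have [x [ax xt Hx]] := arclength_left ltat tb vt'.
  have [|y [/andP[ay yb] yv] xy] := @sup_adherent _ S (t - x) _ hS.
    by rewrite subr_gt0.
  have /arclength_le : a <= x by [].
  move=> /(_ y); rewrite -/t in xy; have xy' : x <= y by lra.
  move=> /(_ xy' yb); lra.
- rewrite leNgt; apply/negP => vt.
  have lttb : t < b.
    rewrite lt_neqAle tb andbT; apply: contraTneq vt => ->.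
    by rewrite -leNgt.
  have vt' : 0 < v - arclength eta a t by lra.
  have [x [tx xb Hx]] := arclength_right at_ lttb vt'.
  have : x <= t.
    apply: ub_le_sup; first by exists b.
    by split; [rewrite xb (le_trans at_ (ltW tx))|lra].
  lra.
Qed.

End Rectifiable.

Definition unit_speed gamma a b := forall s t, a <= s -> s <= t -> t <= b ->
  curve_length gamma s t = (t - s)%:E.

Lemma unit_speed_mdist {gamma a b s t} : unit_speed gamma a b ->
  a <= s -> s <= t -> t <= b -> mdist (gamma s) (gamma t) <= t - s.
Proof.
move=> us as_ st tb; rewrite -lee_fin -(us s t)//; exact: mdist_le_curve_length.
Qed.

Lemma eq_unit_speed {gamma eta a b} :
  (forall x, a <= x <= b -> gamma x = eta x) ->
  unit_speed gamma a b -> unit_speed eta a b.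
Proof.
move=> ge us s t as_ st tb; rewrite -us//; apply: eq_curve_length => x /andP[sx xt].
by rewrite ge// (le_trans as_ sx) (le_trans xt tb).
Qed.

Lemma unit_speedD {gamma a b c} : a <= b -> b <= c ->
  unit_speed gamma a b -> unit_speed gamma b c -> unit_speed gamma a c.
Proof.
move=> ab bc uab ubc s t as_ st tc.
have [tb|bt] := leP t b; first exact: uab.
have [bs|sb] := leP b s; first exact: ubc.
rewrite (curve_lengthD gamma (ltW sb) (ltW bt)) uab ?(ltW sb)// ubc ?(ltW bt)//.
by rewrite -EFinD; congr EFin; lra.
Qed.

(* The reparametrized curve is eta o tau with tau any section of arclength;
   tau may jump, but only across intervals where eta is constant. *)
Lemma unit_speed_reparam {eta a b} T : a <= b -> rectifiable `[a, b] eta ->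
  exists gamma, [/\ unit_speed gamma T (T + arclength eta a b),
    gamma T = eta a & gamma (T + arclength eta a b) = eta b].
Proof.
move=> ab er; set L := arclength eta a b.
pose A := arclength eta a.
have dA s t : a <= s -> s <= t -> t <= b -> mdist (eta s) (eta t) <= A t - A s.
  move=> as_ st tb; rewrite -lee_fin -(curve_length_arclengthB er)//.
  exact: mdist_le_curve_length.
have eqA s t : a <= s <= b -> a <= t <= b -> A s = A t -> eta s = eta t.
  wlog st : s t / s <= t => [H sab tab e|].
    by have [st|/ltW st] := leP s t; [apply: H|apply/esym/H].
  move=> /andP[as_ _] /andP[_ tb] e; apply: mdist_positivity; apply: le_anti.
  by rewrite mdist_ge0 andbT (le_trans (dA s t as_ st tb))// e subrr.
(* The implication makes [tau] total; outside [[T, T + L]] any value will do. *)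
have /choice[tau Htau] r : exists t, T <= r <= T + L -> a <= t <= b /\ A t = r - T.
  have [rT|] := boolP (T <= r <= T + L); last by exists a.
  have [|t Ht] := @arclength_surj _ _ _ er (r - T) ab.
    by case/andP: rT; rewrite -/L => *; apply/andP; split; lra.
  by exists t.
have AL s : a <= s <= b -> T <= T + A s <= T + L.
  move=> /andP[as_ sb]; rewrite lerDl lerD2l (arclength_le er)// andbT.
  by rewrite -(arclengthxx er ab); exact: (arclength_le er).
have tauK s : a <= s <= b -> eta (tau (T + A s)) = eta s.
  move=> sab; have [tab e] := Htau _ (AL _ sab).
  by apply: eqA => //; rewrite e addrC addKr.
have A0 : A a = 0 := arclengthxx er ab.
exists (eta \o tau); split=> /=; first last.
- by apply: tauK; rewrite ab lexx.
- by rewrite -[X in tau X]addr0 -A0 tauK ?ab ?lexx.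
have lip r r' : T <= r -> r <= r' -> r' <= T + L ->
    mdist (eta (tau r)) (eta (tau r')) <= r' - r.
  move=> Tr rr' r'L.
  have [/andP[at_ tb] e] : a <= tau r <= b /\ A (tau r) = r - T.
    by apply: Htau; rewrite Tr (le_trans rr').
  have [/andP[at' tb'] e'] : a <= tau r' <= b /\ A (tau r') = r' - T.
    by apply: Htau; rewrite r'L (le_trans Tr).
  have [tt'|/ltW tt'] := leP (tau r) (tau r').
    by apply: le_trans (dA _ _ at_ tt' tb') _; lra.
  (* If [tau] does not increase from [r] to [r'], monotonicity of [A] forces [r = r'], and the
     distance is 0. *)
  rewrite metric_sym; apply: le_trans (dA _ _ at' tt' tb) _.
  have := arclength_le er at' tt' tb; rewrite -/(A _) -/(A _); lra.
have upper r r' : T <= r -> r <= r' -> r' <= T + L ->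
    (curve_length (eta \o tau) r r' <= (r' - r)%:E)%E.
  move=> Tr _ r'L; apply: curve_length_le => s ps ls.
  rewrite lee_fin; elim: s r Tr ps ls => [|x s IH] r Tr /=; first by move=> _ ->; rewrite subrr.
  move=> /andP[rx xs] ls; have Tx := le_trans Tr (ltW rx).
  have xr' := path_last_ge xs; rewrite ls in xr'.
  have := IH x Tx xs ls; have := lip r x Tr (ltW rx) (le_trans xr' r'L); lra.
have total : (L%:E <= curve_length (eta \o tau) T (T + L))%E.
  rewrite -(curve_length_arclength er) ?ab ?lexx//; apply: curve_length_le => s.
  (* Distinct nodes may have the same image under [A], so a partition of [[a, b]] need not be
     carried to a partition. The edges are therefore compared one at a time, using additivity of
     length. *)
  suff G a' : a <= a' <= b -> path <%R a' s -> last a' s = b ->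
      ((polygon_length eta a' s)%:E <=
        curve_length (eta \o tau) (T + A a') (T + L))%E.
    by have := G a; rewrite A0 addr0; apply; rewrite lexx.
  elim: s a' => [|x s IH] a' a'ab /=.
    by move=> _ _; apply: curve_length_ge0; case/andP: (AL _ a'ab).
  move=> /andP[a'x xs] ls; case/andP: (a'ab) => aa' _.
  have xb := path_last_ge xs; rewrite ls in xb.
  have xab : a <= x <= b by rewrite xb (le_trans aa' (ltW a'x)).
  have Axx' : T + A a' <= T + A x by rewrite lerD2l; exact: (arclength_le er aa' (ltW a'x)).
  have AxL : T + A x <= T + L by case/andP: (AL _ xab).
  rewrite (curve_lengthD _ Axx' AxL) EFinD; apply: leeD; last exact: IH.
  have := mdist_le_curve_length (eta \o tau) Axx'.
  by rewrite /= !tauK.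
(* The points [r] and [r'] cut [[T, T + L]] into three pieces. Each has length at most that of its
   parameter interval and the total is at least [L], so there is equality on the middle one. *)
move=> r r' Tr rr' r'L; apply/eqP; rewrite eq_le upper//=.
have Tr' := le_trans Tr rr'; have rL := le_trans rr' r'L.
move: total; rewrite (curve_lengthD _ Tr rL) (curve_lengthD _ rr' r'L) => total.
have fin x y : T <= x -> x <= y -> y <= T + L ->
    curve_length (eta \o tau) x y \is a fin_num.
  move=> Tx xy yL; rewrite ge0_fin_numE ?curve_length_ge0//.
  by rewrite (le_lt_trans (upper _ _ Tx xy yL))// ltry.
have := upper T r (lexx _) Tr rL; have := upper r' (T + L) Tr' r'L (lexx _).
move: total; rewrite -(fineK (fin T r _ _ _))// -(fineK (fin r r' _ _ _))//.
rewrite -(fineK (fin r' (T + L) _ _ _))// -!EFinD !lee_fin; lra.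
Qed.

End Reparametrization.

(** * From the slope condition to the global 1-Lipschitz bound *)

Section Slope.
Context {R : realType} {Y : metricType R}.
Implicit Types (x y z : Y) (u : Y -> R).

(** Almost shortest curves, parametrized by arclength. The free starting time [T] allows them to be
    appended to a curve that ends at time [T]. *)
Lemma length_space_unit_speed {x y e} T : length_space Y -> 0 < e ->
  exists L gamma, [/\ mdist x y <= L, L < mdist x y + e,
    unit_speed gamma T (T + L), gamma T = x & gamma (T + L) = y].
Proof.
move=> lY e0; have : ((mdist x y)%:E < (mdist x y + e)%:E)%E by rewrite lte_fin ltrDl.
rewrite {1}lY => /ereal_inf_lt[_ [a [b [eta [ab er <- <- ->]]]] Llt].
have [gamma [us g1 g2]] := unit_speed_reparam T (ltW ab) er.
have aab : a <= b <= b by rewrite ltW ?lexx.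
exists (arclength eta a b), gamma; split=> //.
- by rewrite -lee_fin -(curve_length_arclength er)//; apply: mdist_le_curve_length; exact: ltW.
- by rewrite -lte_fin -(curve_length_arclength er).
Qed.

Lemma local_slope_le1 {u y e} : local_slope setT u y = 1%E -> 0 < e ->
  exists2 d, 0 < d & forall x, mdist y x < d -> u y - u x <= (1 + e) * mdist y x.
Proof.
move=> sl e0; have : (local_slope setT u y < (1 + e)%:E)%E.
  by rewrite sl lte_fin ltrDl.
move=> /ereal_inf_lt[_ [V + <-] Vlt].
rewrite /within /= => /nbhs_ballP[d /= d0 H]; exists d => // x yx.
have [->|yNx] := eqVneq y x; first by rewrite subrr mdistxx mulr0.
have Vx : V x by apply: H => //; [rewrite ballEmdist|rewrite eq_sym].
have dyx : 0 < mdist y x by rewrite mdist_gt0.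
rewrite -ler_pdivrMr//; apply: (@le_trans _ _ (Num.max (u y - u x) 0 / mdist y x)).
  by rewrite ler_pM2r ?invr_gt0// le_max lexx.
by rewrite -lee_fin; apply/ltW/(le_lt_trans _ Vlt)/ereal_sup_ubound; exists x.
Qed.

Lemma local_slope_ge1 {u y e r} : local_slope setT u y = 1%E ->
  0 < e < 1 -> 0 < r ->
  exists x, [/\ x != y, mdist y x < r & (1 - e) * mdist y x < u y - u x].
Proof.
move=> sl /andP[e0 e1] r0; pose V := [set x | x != y /\ mdist y x < r].
have : ((1 - e)%:E < ereal_sup [set (Num.max (u y - u x) 0 / mdist y x)%:E | x in V])%E.
  apply: (@lt_le_trans _ _ 1%E); first by rewrite lte_fin; lra.
  rewrite -sl; apply: ereal_inf_lbound; exists V => //.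
  apply/nbhs_ballP; exists r => //= x; rewrite ballEmdist /= => yx xNy _.
  by split.
move=> /ereal_sup_gt[_ [x [xNy yx] <-]]; rewrite lte_fin => H.
have dyx : 0 < mdist y x by rewrite mdist_gt0 eq_sym.
exists x; split=> //; move: H; rewrite ltr_pdivlMr// lt_max => /orP[//|].
(* The positive part is not 0 here: its quotient exceeds [1 - e], which is positive. *)
by rewrite ltNge mulr_ge0// ?mdist_ge0//; lra.
Qed.

(** Continuation argument: the estimate from [a] passes to the supremum of the times where it holds,
    by semicontinuity from the left. The local estimate to the right would carry it further if that
    supremum were less than [b]. *)
Lemma le_sup_continuation {f : R -> R} {a b K} : a <= b -> 0 <= K ->
  (forall t e, a <= t <= b -> 0 < e ->
    exists2 d, 0 < d & forall s, a <= s <= t -> t - d < s -> f s - f t <= e) ->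
  (forall t, a <= t -> t < b ->
    exists2 d, 0 < d & forall s, t <= s <= b -> s < t + d -> f t - f s <= K * (s - t)) ->
  f a - f b <= K * (b - a).
Proof.
move=> ab K0 cf lf; pose S := [set t | a <= t <= b /\ f a - f t <= K * (t - a)].
have Sa : S a by split; rewrite ?lexx ?ab// !subrr mulr0.
have bS : ubound S b by move=> x [/andP[]].
have hS : has_sup S by split; [exists a|exists b].
pose t := sup S.
have at_ : a <= t by apply: ub_le_sup => //; exists b.
have tb : t <= b by apply: ge_sup => //; exists a.
have St : f a - f t <= K * (t - a).
  apply/ler_addgt0Pr => e e0.
  have tab : a <= t <= b by rewrite at_.
  have [d d0 Hd] := cf t e tab e0.
  have [s [/andP[as_ sb] fs] ts] := sup_adherent d0 hS.
  have st : s <= t by apply: ub_le_sup; [exists b|split=> //; rewrite as_].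
  have := Hd s; rewrite as_ st => /(_ isT ts).
  have := ler_wpM2l K0 (lerB st (lexx a)); lra.
move: tb; rewrite le_eqVlt => /predU1P[<-//|tb].
have [d d0 Hd] := lf t at_ tb.
pose s := t + Num.min d (b - t) / 2.
have m0 : 0 < Num.min d (b - t) by rewrite lt_min d0 subr_gt0 tb.
have mt : Num.min d (b - t) <= b - t by rewrite ge_min lexx orbT.
have md : Num.min d (b - t) <= d by rewrite ge_min lexx.
have ts : t < s by rewrite /s; lra.
have sb : s <= b by rewrite /s; lra.
have sd : s < t + d by rewrite /s; lra.
suff : s <= t by rewrite leNgt ts.
apply: ub_le_sup; first by exists b.
split; first by rewrite sb (le_trans at_ (ltW ts)).
by have := Hd s; rewrite (ltW ts) sb => /(_ isT sd); lra.
Qed.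

(** Along an almost shortest unit-speed curve, slope at most 1 gives the local estimate to the right
    with constant [1 + k], and local Lipschitz continuity gives the semicontinuity needed for
    continuation. *)
Lemma viscosity_lipschitz {u} : length_space Y ->
  metric_viscosity_solution setT u -> forall x y, u x - u y <= mdist x y.
Proof.
move=> lY [ll sl] x y; apply/ler_addgt0Pr => e e0.
(* With [d] the distance from [x] to [y], [k <= 1] gives [(1 + k) * (d + k) <= d + k * (d + 2)],
   which is at most [d + e]. *)
pose k := Num.min 1 (e / (mdist x y + 2)).
have dxy := mdist_ge0 x y.
have k0 : 0 < k by rewrite lt_min ltr01 divr_gt0//; lra.
have k1 : k <= 1 by rewrite ge_min lexx.
have ke : k * (mdist x y + 2) <= e by rewrite -ler_pdivlMr ?ge_min ?lexx ?orbT//; lra.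
have [L [c [dL Ld us c0 cL]]] := @length_space_unit_speed x y k 0 lY k0.
rewrite add0r in us cL.
suff : u (c 0) - u (c L) <= (1 + k) * (L - 0) by rewrite c0 cL; nra.
apply: (@le_sup_continuation (u \o c)); [lra|lra| |].
  move=> t d /andP[t0 tL] d0 /=.
  have [M [V [/nbhs_ballP[r /= r0 rV] MV]]] := ll (c t) I.
  (* The local Lipschitz constant [M] may be zero or negative; [M'] can be divided by. *)
  pose M' := Num.max M 1.
  have M'1 : 1 <= M' by rewrite le_max lexx orbT.
  exists (Num.min r (d / M')); first by rewrite lt_min r0 divr_gt0//; lra.
  move=> s /andP[s0 st] ts.
  have dst := unit_speed_mdist us s0 st tL.
  have mr : Num.min r (d / M') <= r by rewrite ge_min lexx.
  have md : Num.min r (d / M') <= d / M' by rewrite ge_min lexx orbT.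
  have Vs : V (c s) by apply: rV; rewrite ballEmdist /= metric_sym; lra.
  have Vt : V (c t) by apply: rV; exact: ballxx.
  have /(le_trans (ler_norm _)) := MV (c s) (c t) (conj Vs I) (conj Vt I).
  move=> /le_trans; apply; apply: (@le_trans _ _ (M' * mdist (c s) (c t))).
    by rewrite ler_wpM2r ?mdist_ge0// le_max lexx.
  rewrite mulrC -ler_pdivlMr; lra.
move=> t t0 tL /=.
have [d d0 Hd] := local_slope_le1 (sl (c t) I) k0.
exists d => // s /andP[ts sL] sd.
have dts := unit_speed_mdist us t0 ts sL.
apply: le_trans (Hd (c s) _) _; first lra.
by rewrite ler_wpM2l//; lra.
Qed.

End Slope.

(** * Ekeland's principle and a descent step of definite size *)

Section Ekeland.
Context {R : realType} {Y : completeMetricType R}.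

(* The cone order "u x - u z >= K d(x, z)" has minimal elements: along a chain,
   the points form a Cauchy filter because u is bounded below. *)
Lemma ekeland_minimal {A : set Y} {u : Y -> R} {m K : R} {y : Y} :
  closed A -> continuous u -> (forall x, A x -> m <= u x) -> 0 < K -> A y ->
  exists x, [/\ A x, K * mdist y x <= u y - u x &
    forall z, A z -> K * mdist x z <= u x - u z -> z = x].
Proof.
move=> clA cu um K0 Ay.
pose le x z := K * mdist x z <= u x - u z.
have letr x z w : le x z -> le z w -> le x w.
  move=> xz zw; have := ler_wpM2l (ltW K0) (metric_triangle x z w).
  by move: xz zw; rewrite /le; lra.
have lerefl x : le x x by rewrite /le mdistxx mulr0 subrr.
(* Restricting Zorn's lemma to the points reached from [y] makes the resulting point satisfy the
   estimate from [y] as well. *)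
pose T := {x | A x /\ le y x}.
pose y' : T := exist _ y (conj Ay (lerefl y)).
have [||||[x [Ax yx]] Hx] := @Zorn T (fun s t => le (sval s) (sval t)).
- by [].
- by move=> r s t; exact: letr.
- move=> [s Hs] [t Ht] /= st ts; apply: eq_exist; apply: mdist_positivity.
  apply: le_anti; rewrite mdist_ge0 andbT -(pmulr_rle0 _ K0).
  by move: st ts; rewrite /le (metric_sym t); lra.
- move=> C totC; have [->|/set0P[c0 Cc0]] := eqVneq C set0; first by exists y'.
  pose D (c : T) := [set sval x | x in [set x : T | C x /\ le (sval c) (sval x)]].
  pose F := filter_from C D.
  have PF : ProperFilter F.
    apply: filter_from_proper; last by move=> c Cc; exists (sval c), c.
    apply: filter_from_filter; first by exists c0.
    move=> c d Cc Cd; have [cd|dc] := totC c d Cc Cd.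
      by exists d => // _ [x [Cx dx] <-]; split; exists x => //; split=> //; exact: letr cd dx.
    by exists c => // _ [x [Cx cx] <-]; split; exists x => //; split=> //; exact: letr dc cx.
  have cF : cauchy F.
    apply: cauchy_exP => e e0.
    (* Beyond a point [c] of the chain where [u] is within [K * e] of its infimum over [C], [u]
       drops by less than [K * e], so all later points are within [e] of [c]. *)
    pose G := [set u (sval x) | x in C].
    have hG : has_inf G.
      split; first by exists (u (sval c0)), c0.
      by exists m => _ [[x [Ax ?]] _ <-]; exact: um.
    have [_ [c Cc <-] cG] := inf_adherent (mulr_gt0 K0 e0) hG.
    exists (sval c), c => // _ [x [Cx cx] <-]; rewrite ballEmdist /=.
    rewrite -(ltr_pM2l K0); apply: le_lt_trans cx _.
    by have : inf G <= u (sval x); [apply: ge_inf; [case: hG|exists x]|lra].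
  have Fl := cauchy_cvg F cF; set l := lim F in Fl.
  have AF : F A by exists c0 => // _ [[x [Ax ?]] _ <-].
  have Al : A l.
    by apply: clA => B /Fl FB; exact: filter_ex (filterI AF FB).
  have Cl c : C c -> le (sval c) l.
    move=> Cc; apply/ler_addgt0Pr => e e0.
    (* Passing to the limit costs [K * e'] in the distance term and [e'] in the value of [u],
       together [e]. *)
    pose e' := e / (K + 1).
    have e'0 : 0 < e' by rewrite divr_gt0//; lra.
    have ee : e = K * e' + e'.
      by rewrite -[X in _ + X]mul1r -mulrDl /e' mulrC divfK//; lra.
    have Fd : F (D c) by exists c.
    have Fb : F (ball l e') by apply: Fl; exact: nbhsx_ballx.
    have Fu : F [set x | `|u l - u x| < e'].
      by apply: Fl; move: (cu l) => /cvgrPdist_lt/(_ _ e'0).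
    have [_ [[[x [Cx cx] <-] +] +]] := filter_ex (filterI (filterI Fd Fb) Fu).
    rewrite ballEmdist /= metric_sym ltr_norml => lx /andP[lu1 lu2].
    have := ler_wpM2l (ltW K0) (metric_triangle (sval c) (sval x) l).
    have := ler_wpM2l (ltW K0) (ltW lx).
    by move: cx; rewrite /le; lra.
  exists (exist _ l (conj Al (letr _ _ _ (proj2 (svalP c0)) (Cl _ Cc0)))).
  by move=> s /Cl.
- exists x; split=> // z Az xz.
  by have /= := Hx (exist _ z (conj Az (letr _ _ _ yx xz))) xz => /(congr1 sval)/= ->.
Qed.

Lemma closed_mdist_le (y : Y) (r : R) : closed [set x | mdist y x <= r].
Proof.
move=> x clx; apply/ler_addgt0Pr => e e0.
have [z [/= yz]] := clx _ (nbhsx_ballx x e e0); rewrite ballEmdist /= => xz.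
have := metric_triangle y z x; rewrite (metric_sym z); lra.
Qed.

(** The lower bound 1 guarantees progress at each extension; the upper bound 2, from the radius 1 of
    the ball and a step shorter than 1, keeps the loss [e * mdist y z] below [2 * e]. *)
Lemma viscosity_descent {u : Y -> R} {e : R} (y : Y) : length_space Y ->
  metric_viscosity_solution setT u -> 0 < e < 1 ->
  exists z, 1 < mdist y z <= 2 /\ (1 - e) * mdist y z <= u y - u z.
Proof.
move=> lY vu e01; have /andP[e0 e1] := e01.
have Lu := viscosity_lipschitz lY vu.
have cu : continuous u.
  move=> x; apply/cvgrPdist_lt => d d0; apply/nbhs_ballP; exists d => //= z.
  rewrite ballEmdist /= => xz; have := Lu x z; have := Lu z x.
  by rewrite (metric_sym z) ltr_norml => ? ?; apply/andP; split; lra.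
have um x : mdist y x <= 1 -> u y - 1 <= u x by have := Lu y x; lra.
have k0 : 0 < 1 - e by lra.
have yy : mdist y y <= 1 by rewrite mdistxx.
have [x [yx uyx minx]] := ekeland_minimal (closed_mdist_le y 1) cu um k0 yy.
have [z [zNx xz uxz]] := local_slope_ge1 (vu.2 x I) e01 ltr01.
have tri := metric_triangle y x z.
exists z; split; last first.
  have := ler_wpM2l (ltW k0) tri; lra.
rewrite /= in yx; apply/andP; split; last lra.
by rewrite ltNge; apply: contra zNx => yz; apply/eqP/minx => //; exact: ltW.
Qed.

End Ekeland.

(** * Construction of the ray by repeated extension *)

Section Extension.
Context {R : realType} {Y : completeMetricType R} {u : Y -> R}.
Hypotheses (lY : length_space Y) (vu : metric_viscosity_solution setT u).

(* The strict inequality leaves some slack, which pays for the errors of the next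
   extension: no explicit summable sequence is needed. *)
Definition descending_curve (y0 : Y) (eps : R) (p : R * (R -> Y)) :=
  [/\ 0 <= p.1, p.2 0 = y0, unit_speed p.2 0 p.1
    & p.1 - eps < u y0 - u (p.2 p.1)].

Lemma descending_curve_extend {y0 : Y} {eps : R} {p} :
  descending_curve y0 eps p -> exists q, [/\ descending_curve y0 eps q,
    p.1 + 1 <= q.1 & forall t, t <= p.1 -> q.2 t = p.2 t].
Proof.
case: p => T g [/= T0 g0 us slack].
pose k := u y0 - u (g T) - T + eps.
have k0 : 0 < k by rewrite /k; lra.
(* The slack [k] must pay less than [e] for the excess length of the new piece and at most [2 * e]
   for the defect in the descent. With [e <= k / 4] some slack survives; [e <= 1 / 2] keeps [e]
   below 1. *)
pose e := Num.min (k / 4) (1 / 2).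
have e0 : 0 < e by rewrite lt_min; apply/andP; split; lra.
have ek : e <= k / 4 by rewrite ge_min lexx.
have e12 : e <= 1 / 2 by rewrite ge_min lexx orbT.
have e01 : 0 < e < 1 by rewrite e0; lra.
have [z [/andP[z1 z2] uz]] := viscosity_descent (g T) lY vu e01.
have [L [c [dL Ld uc cT cL]]] := length_space_unit_speed (x := g T) (y := z) T lY e0.
pose h t := if t <= T then g t else c t.
have hg t : t <= T -> h t = g t by rewrite /h => ->.
(* Both pieces take the value [g T] at [T], so [h] agrees with [c] on a closed interval and unit
   speed can be joined at [T]. *)
have hc t : T <= t -> h t = c t.
  by rewrite /h le_eqVlt => /predU1P[<-|Tt]; [rewrite lexx cT|rewrite leNgt Tt].
exists (T + L, h); split=> //=; last by lra.
split=> /=; first lra.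
- by rewrite hg.
- apply: (@unit_speedD _ _ _ _ T); [by []|lra| |].
    by apply: eq_unit_speed us => x /andP[_ xT]; rewrite hg.
  by apply: eq_unit_speed uc => x /andP[Tx _]; rewrite hc.
- rewrite hc ?cL; last lra.
  have := ler_pM2l e0 (mdist (g T) z) 2; rewrite z2 => eD.
  move: uz slack; rewrite /k in ek *; lra.
Qed.

Lemma descending_ray {y0 : Y} {eps : R} : 0 < eps -> exists gamma : R -> Y,
  [/\ gamma 0 = y0, forall T, unit_speed gamma 0 T &
    forall s t, 0 <= s -> s <= t -> t - s - eps <= u (gamma s) - u (gamma t)].
Proof.
move=> eps0; have Lu := viscosity_lipschitz lY vu.
(* Made conditional so that choice gives an extension operator on all pairs, which can be
   iterated. *)
pose ext p q := descending_curve y0 eps p -> [/\ descending_curve y0 eps q,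
    p.1 + 1 <= q.1 & forall t, t <= p.1 -> q.2 t = p.2 t].
have /choice[F HF] p : exists q, ext p q.
  have [/descending_curve_extend[q Hq]|np] := pselect (descending_curve y0 eps p).
    by exists q.
  by exists p.
(* The start is a constant curve on the degenerate interval [[0, 0]], with the whole of [eps] as
   slack. *)
pose P n := iter n F (0, cst y0).
have P0 : descending_curve y0 eps (P 0%N).
  split=> //=; last by rewrite !subrr; lra.
  move=> s t s0 st t0; have -> : s = t by lra.
  have t00 : 0 <= t by lra.
  rewrite subrr; apply/eqP; rewrite eq_le curve_length_ge0// andbT.
  apply: curve_length_le => -[//|x r] /= /andP[tx /path_last_ge xr] rt.
  by move: tx; rewrite ltNge -{1}rt xr.
have Pd n : descending_curve y0 eps (P n) by elim: n => //= n /HF[].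
have Pstep n : (P n).1 + 1 <= (P n.+1).1 by have [] := HF _ (Pd n).
have Pmono m n : (m <= n)%N -> (P m).1 <= (P n).1 /\
    forall t, t <= (P m).1 -> (P n).2 t = (P m).2 t.
  elim: n => [|n IH]; first by rewrite leqn0 => /eqP ->.
  rewrite leq_eqVlt => /predU1P[->//|/IH[mn e]].
  have [_ nS eS] := HF _ (Pd n).
  split; first by have := Pstep n; lra.
  by move=> t tm; rewrite -e//= eS//; lra.
have Pn n : n%:R <= (P n).1.
  by elim: n => // n IH; have := Pstep n; rewrite -natr1; lra.
(* Stage [n] reaches at least time [n], so this stage covers [t]; by compatibility every other stage
   that covers [t] gives the same value. *)
pose gamma t := (P (Num.truncn t).+1).2 t.
have gP n t : 0 <= t -> t <= (P n).1 -> gamma t = (P n).2 t.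
  move=> t0 tn; rewrite /gamma; set m := (Num.truncn t).+1.
  have tm : t <= (P m).1 by apply: le_trans (ltW (truncnS_gt t)) (Pn _).
  by have [/Pmono[_ ->]//|/ltnW/Pmono[_ ->]] := leqP m n.
have Parch (T : R) : exists n, T <= (P n).1.
  by exists (Num.truncn T).+1; apply: le_trans (ltW (truncnS_gt T)) (Pn _).
exists gamma; split.
- by rewrite (gP 0%N)//; have [] := Pd 0%N.
- move=> T; have [n Tn] := Parch T; have [_ _ us _] := Pd n.
  move=> s t s0 st tT; rewrite -(us s t)//; last exact: le_trans Tn.
  apply: eq_curve_length => x /andP[sx xt].
  by rewrite (gP n)//; [exact: le_trans sx|exact: le_trans xt (le_trans tT Tn)].
(* From the drop over the whole of stage [n], subtract the drops before [s] and after [t]: each is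
   at most the elapsed time, as [u] is 1-Lipschitz. *)
- move=> s t s0 st; have [n tn] := Parch t; have [Pn0 g0 us sl] := Pd n.
  have t0 := le_trans s0 st.
  rewrite !(gP n)//; last exact: le_trans tn.
  have := le_trans (Lu _ _) (unit_speed_mdist us (lexx _) s0 (le_trans st tn)).
  have := le_trans (Lu _ _) (unit_speed_mdist us t0 tn (lexx _)).
  rewrite g0; lra.
Qed.

End Extension.

(** * Regularity of unit-speed rays and the final assembly *)

Lemma unit_speed_regular {R : realType} {Y : metricType R} {gamma : R -> Y} :
  (forall T, unit_speed gamma 0 T) -> regular_curve 0 `[0, +oo[ gamma.
Proof.
move=> us; split; first split.
- apply/subspace_continuousP => t /=; rewrite in_itv /= andbT => t0.
  apply/metricType_numDomainType.cvgrPdist_lt => e e0.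
  apply/nbhs_ballP; exists e => //= s ts; rewrite in_itv /= andbT => s0.
  move: ts; rewrite /ball /= ltr_norml => /andP[ts1 ts2].
  have [ts|/ltW st] := leP t s.
    by apply: le_lt_trans (unit_speed_mdist (us s) t0 ts (lexx _)) _; lra.
  rewrite metric_sym.
  by apply: le_lt_trans (unit_speed_mdist (us t) s0 st (lexx _)) _; lra.
- move=> a b; rewrite !in_itv /= !andbT => a0 b0 ab.
  by rewrite (us b)// ltry.
have arcE (t : R) : 0 <= t -> arclength gamma 0 t = t.
  by move=> t0; rewrite /arclength (us t)//= subr0.
have der (t : R) : 0 < t -> is_derive t 1 (arclength gamma 0) 1.
  move=> t0; apply: (near_eq_is_derive (f := id)) => //.
  by near=> s; rewrite arcE//; apply: ltW; near: s; exact: lt_nbhsr.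
(* The arclength has a corner at 0: for negative times [curve_length] is [-oo], which [fine] sends
   to 0. This single point is negligible. *)
exists [set 0]; split; [exact: measurable_set1|exact: lebesgue_measure_set1|].
move=> t /=; apply: contra_notP => tN0; rewrite in_itv /= andbT => t0.
have {}t0 : 0 < t by rewrite lt_neqAle t0 andbT eq_sym; apply/eqP.
have dt := der t t0; split; first exact: ex_derive.
by rewrite derive1E derive_val oner_neq0.
Unshelve. all: by end_near.
Qed.

Theorem theorem1p7 (R : realType) (Y : completeMetricType R) (u : Y -> R) :
  length_space Y -> unbounded_space Y ->
  metric_viscosity_solution [set: Y] u ->
  forall (y0 : Y) (eps : R), 0 < eps ->
  exists gamma : R -> Y,
    [/\ regular_curve 0 `[0, +oo[ gamma,
        gamma 0 = y0,
        forall t1 t2 : R, 0 <= t1 -> t1 <= t2 ->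
          u (gamma t1) - u (gamma t2) >= mdist (gamma t2) (gamma t1) - eps
      & mdist y0 (gamma t) @[t --> +oo] --> +oo].
Proof.
move=> lY _ vu y0 eps eps0.
have [gamma [g0 us desc]] := descending_ray lY vu (y0 := y0) eps0.
exists gamma; split=> //; first exact: unit_speed_regular.
  move=> s t s0 st; rewrite metric_sym.
  have := unit_speed_mdist (us t) s0 st (lexx _); have := desc s t s0 st; lra.
(* The distance from [y0] to [gamma t] is at least the drop of [u], hence at least [t - eps]; so
   [t >= M + eps] is enough. *)
apply/cvgryPge => M; near=> t.
have t0 : 0 <= t by near: t; exact: nbhs_pinfty_ge (num_real _).
have Mt : M + eps <= t by near: t; exact: nbhs_pinfty_ge (num_real _).
have := desc 0 t (lexx _) t0; have := viscosity_lipschitz lY vu y0 (gamma t).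
rewrite g0; lra.
Unshelve. all: by end_near.
Qed.
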